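(* Let $X$ be a space and $Y\subseteq X$. If there is a non-zero $k$-fold product of elements of $Z(X\times Y)$, i.e. there are $\alpha_1,\dots,\alpha_k\in Z(X\times Y)$ with $\alpha_1\cdots\alpha_k\ne 0$ in $H^*(X\times Y)$, then $\operatorname{TC}(X,Y)>k$.
   Context: For a continuous map (fibration) $f:E\to B$, the Schwarz genus $\operatorname{genus}(f)$ is the smallest $k$ such that $B$ has an open cover $U_1,\dots,U_k$ for which each $U_i$ admits a continuous section $s_i:U_i\to E$ of $f$ (and $\infty$ if there is no such $k$). For $Y\subseteq X$, let $P_{X\times Y}$ be the space of continuous paths $\gamma:[0,1]\to X$ with $\gamma(1)\in Y$, and let $\pi:P_{X\times Y}\to X\times Y$, $\pi(\gamma)=(\gamma(0),\gamma(1))$. The relative topological complexity of the pair is $\operatorname{TC}(X,Y)=\operatorname{genus}(\pi)$ (unreduced convention). $H^*$ is singular cohomology (with coefficients in a fixed commutative ring) with its cup product. The zero-divisors are $Z(X\times Y)=\ker\big(\Delta_Y^*:H^*(X\times Y)\to H^*(Y)\big)$, where $\Delta_Y:Y\to X\times Y$, $\Delta_Y(y)=(y,y)$. *)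

(* Defs.v *)
From HB Require Import structures.
From mathcomp Require Import all_boot all_order all_algebra.
From mathcomp Require Import generic_quotient ring_quotient.
From mathcomp Require Import zify.
From mathcomp Require Import all_classical all_reals all_analysis.

Set Implicit Arguments.
Unset Strict Implicit.
Unset Printing Implicit Defensive.

Import Order.TTheory GRing.Theory Num.Theory.
Import numFieldNormedType.Exports.

Local Open Scope classical_set_scope.
Local Open Scope ring_scope.
Local Open Scope quotient_scope.

(* Subsets carry the topology of [subtype_topology] when used as types. *)
Definition std_simplex (R : realType) (n : nat) : set 'rV[R]_n.+1 :=
  [set t | (forall i, 0 <= t 0 i) /\ \sum_i t 0 i = 1].
Arguments std_simplex R n : clear implicits.

Section VertexMap.
Context {R : realType}.

Definition push_row {m n} (h : 'I_m.+1 -> 'I_n.+1) (t : 'rV[R]_m.+1)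
  : 'rV[R]_n.+1 := \row_j \sum_(i | h i == j) t 0 i.

Lemma push_rowP m n (h : 'I_m.+1 -> 'I_n.+1) (t : std_simplex R m) :
  push_row h (val t) \in std_simplex R n.
Proof.
case: t => t /=; rewrite !inE => -[t0 t1]; split.
  by move=> i; rewrite mxE sumr_ge0.
under eq_bigr do rewrite mxE.
by rewrite -t1 (partition_big h xpredT).
Qed.

(* The affine map sending the vertex [e_i] to the vertex [e_(h i)]. *)
Definition vertex_map {m n} (h : 'I_m.+1 -> 'I_n.+1) (t : std_simplex R m)
  : std_simplex R n := exist _ (push_row h (val t)) (push_rowP h t).

Lemma vertex_map_continuous m n (h : 'I_m.+1 -> 'I_n.+1) :
  continuous (vertex_map h).
Proof.
apply: (@continuous_comp_initial _ _ _ set_val) => t.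
have cpush : continuous (push_row h : 'rV[R]_m.+1 -> 'rV[R]_n.+1).
  move=> u A [P uP sPA].
  have : \forall v \near u, forall i j, P i j (push_row h v i j).
    apply: (@filter_forall _ _ _ (nbhs u)) => i.
    apply: (@filter_forall _ _ _ (nbhs u)) => j.
    suff cij : continuous (fun v : 'rV[R]_m.+1 => push_row h v i j).
      exact: (cij u _ (uP i j)).
    rewrite (_ : (fun _ => _) =
        (fun v : 'rV[R]_m.+1 => \sum_(k | h k == j) v 0 k)); last first.
      by apply/funext => v; rewrite mxE.
    move=> v; apply: (cvg_big (F := nbhs v) add_continuous) => k _.
    exact: coord_continuous.
  by apply: filterS => v; exact: sPA.
apply: (@continuous_comp _ _ _ set_val (push_row h)); last exact: cpush.
exact: initial_continuous.
Qed.

HB.instance Definition _ m n (h : 'I_m.+1 -> 'I_n.+1) :=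
  @isContinuous.Build _ _ (vertex_map h) (@vertex_map_continuous m n h).

End VertexMap.

Definition singular (R : realType) (n : nat) (X : topologicalType) : Type :=
  continuousType (std_simplex R n) X.

Section Faces.
Context {R : realType} {X : topologicalType}.

(* The restriction of [s] to the face with vertices [h 0, ..., h m].  It is
   only used with [h i <= n] for all [i <= m]: otherwise [inord] takes a junk
   value. *)
Definition face {n} (m : nat) (h : nat -> nat) (s : singular R n X)
  : singular R m X :=
  s \o vertex_map (fun i : 'I_m.+1 => inord (h i) : 'I_n.+1).

Lemma eq_face n m (h k : nat -> nat) (s : singular R n X) :
  (forall i, (i <= m)%N -> h i = k i) -> face m h s = face m k s.
Proof.
move=> hk; rewrite /face; set f := (fun _ => _); set g := (fun _ => _).
suff -> : f = g by [].
by apply/funext => i; rewrite /f /g hk // -ltnS.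
Qed.

Lemma face_face n p m (h k : nat -> nat) (s : singular R n X) :
  (forall i, (i <= m)%N -> (k i <= p)%N) ->
  face m k (face p h s) = face m (h \o k) s.
Proof.
move=> kp; apply/continuousEP => t /=; congr (s _); apply: val_inj => /=.
apply/rowP => j; rewrite !mxE.
under eq_bigr do rewrite mxE.
pose kk (i : 'I_m.+1) : 'I_p.+1 := inord (k i).
rewrite [RHS](partition_big kk (fun i => inord (h i) == j)) /=; last first.
  by move=> i; rewrite /kk inordK // ltnS kp // -ltnS.
apply: eq_bigr => i /eqP hij; apply: eq_bigl => l.
rewrite -/(kk l); have [kli|] := eqVneq (kk l) i; last by rewrite andbF.
rewrite andbT -hij -kli /kk inordK ?eqxx //.
by rewrite ltnS kp // -ltnS.
Qed.

Lemma face_id n (s : singular R n X) : face n id s = s.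
Proof.
apply/continuousEP => t /=; congr (s _); apply: val_inj => /=.
apply/rowP => j; rewrite !mxE (big_pred1 j) // => i.
by rewrite inord_val.
Qed.

End Faces.

(* C^*(X; K) is the direct sum over n of the groups of functions on singular
   n-simplices: its elements are the families vanishing in large degrees. *)
Definition bounded_family (R : realType) (K : comPzRingType)
    (X : topologicalType) (u : forall n, singular R n X -> K) : Prop :=
  exists N, forall n (s : singular R n X), (N <= n)%N -> u n s = 0.

Record cochain (R : realType) (K : comPzRingType) (X : topologicalType) :=
  Cochain {
    cochain_fun :> forall n, singular R n X -> K;
    cochain_bounded : bounded_family cochain_fun }.

HB.instance Definition _ R K X := gen_eqMixin (cochain R K X).
HB.instance Definition _ R K X := gen_choiceMixin (cochain R K X).

Section CochainRing.
Context {R : realType} {K : comPzRingType} {X : topologicalType}.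
Local Notation cochain := (cochain R K X).
Implicit Types (a b c : cochain).

Lemma cochainP a b : (forall n (s : singular R n X), a n s = b n s) -> a = b.
Proof.
case: a b => [a aP] [b bP] /= ab.
have eab : a = b.
  by apply: functional_extensionality_dep => n; apply/funext => s; apply: ab.
by rewrite eab in aP *; congr Cochain; apply: Prop_irrelevance.
Qed.

Fact cochain_zero_bounded :
  bounded_family (fun n (s : singular R n X) => 0 : K).
Proof. by exists 0%N. Qed.
Definition cochain_zero : cochain := Cochain cochain_zero_bounded.

Fact cochain_opp_bounded a :
  bounded_family (fun n (s : singular R n X) => - a n s).
Proof. by have [N aN] := cochain_bounded a; exists N => n s /aN->; rewrite oppr0. Qed.
Definition cochain_opp a : cochain := Cochain (cochain_opp_bounded a).

Fact cochain_add_bounded a b :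
  bounded_family (fun n (s : singular R n X) => a n s + b n s).
Proof.
have [N aN] := cochain_bounded a; have [M bM] := cochain_bounded b.
by exists (N + M)%N => n s NMn; rewrite aN ?bM ?addr0 //;
  apply: leq_trans NMn; rewrite ?leq_addl ?leq_addr.
Qed.
Definition cochain_add a b : cochain := Cochain (cochain_add_bounded a b).

Lemma cochain_addA : associative cochain_add.
Proof. by move=> a b c; apply: cochainP => n s /=; rewrite addrA. Qed.
Lemma cochain_addC : commutative cochain_add.
Proof. by move=> a b; apply: cochainP => n s /=; rewrite addrC. Qed.
Lemma cochain_add0 : left_id cochain_zero cochain_add.
Proof. by move=> a; apply: cochainP => n s /=; rewrite add0r. Qed.
Lemma cochain_addN : left_inverse cochain_zero cochain_opp cochain_add.
Proof. by move=> a; apply: cochainP => n s /=; rewrite addNr. Qed.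

HB.instance Definition _ := GRing.isZmodule.Build cochain
  cochain_addA cochain_addC cochain_add0 cochain_addN.

Fact cochain_one_bounded :
  bounded_family (fun n (s : singular R n X) => (n == 0)%:R : K).
Proof. by exists 1%N => -[]. Qed.
Definition cochain_one : cochain := Cochain cochain_one_bounded.

(* On the n-simplex [s], the sum over p + q = n of the value of [a] on the
   front p-face of [s] times the value of [b] on its back q-face. *)
Definition cup_fun a b n (s : singular R n X) : K :=
  \sum_(p < n.+1) a p (face p id s) * b (n - p)%N (face (n - p) (addn p) s).

Fact cup_bounded a b : bounded_family (cup_fun a b).
Proof.
have [N aN] := cochain_bounded a; have [M bM] := cochain_bounded b.
exists (N + M)%N => n s NMn; apply: big1 => p _.
have [Np|pN] := leqP N p; first by rewrite aN ?mul0r.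
have Mnp : (M <= n - p)%N.
  rewrite leq_subRL; last by rewrite -ltnS.
  by apply: leq_trans NMn; rewrite leq_add2r ltnW.
by rewrite (bM _ _ Mnp) mulr0.
Qed.
Definition cup a b : cochain := Cochain (cup_bounded a b).

Lemma cupl1 : left_id cochain_one cup.
Proof.
move=> a; apply: cochainP => n s /=; rewrite /cup_fun big_ord_recl /= mul1r big1 ?addr0.
  by rewrite subn0 (eq_face (k := id)) ?face_id.
by move=> i _; rewrite mul0r.
Qed.

Lemma cupr1 : right_id cochain_one cup.
Proof.
move=> a; apply: cochainP => n s /=; rewrite /cup_fun big_ord_recr /= subnn mulr1 big1.
  by rewrite add0r face_id.
by move=> i _; rewrite subn_eq0 leqNgt ltn_ord mulr0.
Qed.

Lemma cupDl : left_distributive cup cochain_add.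
Proof.
move=> a b c; apply: cochainP => n s /=; rewrite /cup_fun -big_split /=.
by apply: eq_bigr => i _; rewrite mulrDl.
Qed.

Lemma cupDr : right_distributive cup cochain_add.
Proof.
move=> a b c; apply: cochainP => n s /=; rewrite /cup_fun -big_split /=.
by apply: eq_bigr => i _; rewrite mulrDr.
Qed.

Lemma cupA : associative cup.
Proof.
move=> a b c; apply: cochainP => n s /=; rewrite /cup_fun /=.
pose A r := a r (face r id s).
pose B r q := b q (face q (addn r) s).
pose C r q := c q (face q (addn r) s).
transitivity (\sum_(0 <= r < n.+1) \sum_(0 <= q < (n - r).+1)
    A r * (B r q * C (r + q)%N (n - (r + q))%N)).
  rewrite big_mkord; apply: eq_bigr => r _; rewrite big_distrr big_mkord /=.
  have rn : (r <= n)%N by rewrite -ltnS.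
  apply: eq_bigr => q _; have qn : (q <= n - r)%N by rewrite -ltnS.
  congr (_ * (_ * _)); rewrite /cup_fun face_face /B /C ?subnDA //.
  - by move=> i iq; apply: leq_trans qn.
  - by congr (c _ _); apply: eq_face => i _ /=; rewrite addnA.
  - by move=> i iq; rewrite -leq_subRL.
transitivity (\sum_(0 <= p < n.+1) \sum_(0 <= r < p.+1)
    A r * (B r (p - r)%N * C p (n - p)%N)); last first.
  rewrite big_mkord; apply: eq_bigr => p _; rewrite big_distrl big_mkord /=.
  apply: eq_bigr => r _; have rp : (r <= p)%N by rewrite -ltnS.
  rewrite mulrA !face_face //.
    by move=> i iq; rewrite -leq_subRL.
  by move=> i ir; apply: leq_trans rp.
pose G r p := A r * (B r (p - r)%N * C p (n - p)%N).
transitivity (\sum_(0 <= p < n.+1) \sum_(0 <= r < n.+1 | (r < p.+1)%N) G r p).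
  rewrite (exchange_big_dep_nat xpredT) //=.
  apply: eq_big_nat => r /andP[_ rn].
  transitivity (\sum_(0 + r <= p < n.+1) G r p); last first.
    by rewrite add0n (big_nat_widenl r 0).
  rewrite big_addn subSn; last by rewrite -ltnS.
  apply: eq_bigr => q _.
  by rewrite /G addnK (addnC r).
by apply: eq_big_nat => p /andP[_ pn]; rewrite [RHS](big_nat_widen _ _ n.+1).
Qed.

HB.instance Definition _ := GRing.Zmodule_isPzRing.Build cochain
  cupA cupl1 cupr1 cupDl cupDr.

End CochainRing.
Section Cohomology.
Context {R : realType} {K : comPzRingType} {X : topologicalType}.
Local Notation cochain := (cochain R K X).
Implicit Types (a b c : cochain).

(* [bump i] skips i, so [face n (bump i) s] is the i-th face of [s]. *)
Definition delta_fun a n : singular R n X -> K :=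
  if n is n'.+1 then
    fun s => \sum_(i < n'.+2) (-1) ^+ i * a n' (face n' (bump i) s)
  else fun=> 0.

Fact delta_bounded a : bounded_family (delta_fun a).
Proof.
have [N aN] := cochain_bounded a; exists N.+1 => -[//|n] s /= Nn.
by apply: big1 => i _; rewrite aN ?mulr0.
Qed.

Definition delta a : cochain := Cochain (delta_bounded a).

Fact delta_is_zmod_morphism : zmod_morphism delta.
Proof.
move=> a b; apply: cochainP => -[|n] s /=; first by rewrite subr0.
rewrite -sumrN -big_split /=; apply: eq_bigr => i _.
by rewrite mulrDr mulrN.
Qed.
HB.instance Definition _ :=
  GRing.isZmodMorphism.Build cochain cochain delta delta_is_zmod_morphism.

Lemma delta_delta a : delta (delta a) = 0.
Proof.
apply: cochainP => -[//|[|n]] s /=.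
  by rewrite !big_ord_recl big_ord0 /= !mulr0 !addr0.
pose t i j := (-1) ^+ (i + j) * a n (face n (bump j \o bump i) s).
transitivity (\sum_(0 <= j < n.+3) \sum_(0 <= i < n.+2) t i j).
  rewrite big_mkord; apply: eq_bigr => j _; rewrite big_mkord mulr_sumr.
  apply: eq_bigr => i _; rewrite mulrA -exprD addnC face_face // => l ln.
  by apply: (@leq_add _ _ 1 n); rewrite ?leq_b1.
under eq_bigr => j _ do rewrite (bigID (fun i => (i < j)%N)) /=.
rewrite big_split /= big_nat_recl //.
have -> : \sum_(0 <= i < n.+2 | (i < 0)%N) t i 0%N = 0 by exact: big_pred0.
rewrite add0r.
rewrite [X in _ + X](exchange_big_dep_nat xpredT) //= -big_split /=.
apply: big1_seq => i; rewrite mem_index_iota => /andP[_ /andP[_ i2]].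
have -> : \sum_(0 <= j < n.+2 | (j < i.+1)%N) t j i.+1 =
    \sum_(0 <= j < n.+3 | ~~ (i < j)%N) t j i.+1.
  rewrite [RHS]big_mkcond big_nat_recr //= i2 /= addr0 -big_mkcond.
  apply: eq_bigl => j.
  by rewrite -leqNgt ltnS.
rewrite -big_split /=; apply: big1 => j; rewrite -leqNgt => ji.
rewrite /t addnS exprS mulN1r mulNr (addnC i) addrC.
suff -> : face n (bump j \o bump i) s = face n (bump i.+1 \o bump j) s.
  by rewrite subrr.
apply: eq_face => l _ /=; rewrite /bump.
by case: (leqP i l) => il; case: (leqP j l) => jl; lia.
Qed.

Fact sign_bounded a : bounded_family (fun n s => (-1) ^+ n * a n s).
Proof.
by have [N aN] := cochain_bounded a; exists N => n s /aN->; rewrite mulr0.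
Qed.

Definition sign_involution a : cochain := Cochain (sign_bounded a).

Lemma sign_involutionK : involutive sign_involution.
Proof. by move=> a; apply: cochainP => n s /=; rewrite signrMK. Qed.

Lemma delta_sign a : delta (sign_involution a) = - sign_involution (delta a).
Proof.
apply: cochainP => -[|n] s /=; first by rewrite mulr0 oppr0.
rewrite exprS mulN1r mulNr opprK mulr_sumr; apply: eq_bigr => i _.
by rewrite mulrCA.
Qed.

Lemma delta_cup a b : delta (a * b) = delta a * b + sign_involution a * delta b.
Proof.
apply: cochainP => -[|n] s.
  by rewrite /= /cup_fun !big_ord_recl !big_ord0 /= mul0r mulr0 !addr0.
pose f p i := a p (face p (bump i) s).
pose f0 p := a p (face p id s).
pose g p i := b (n - p)%N (face (n - p) (fun l => p + bump i l)%N s).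
pose g0 p := b (n - p)%N (face (n - p) (addn p.+1) s).
have g00 p : g p 0%N = g0 p.
  by congr (b _ _); apply: eq_face => i _; rewrite /bump /= add1n addSnnS.
have ffl p : f p p.+1 = f0 p.
  by congr (a _ _); apply: eq_face => i ip; rewrite /bump ltnNge ip.
have fgE (p : 'I_n.+1) : \sum_(i < n.+2) (-1) ^+ i *
    (a p (face p id (face n (bump i) s)) *
     b (n - p)%N (face (n - p) (addn p) (face n (bump i) s))) =
  \sum_(i < p.+1) (-1) ^+ i * (f p i * g0 p) +
  \sum_(i < (n - p).+1) (-1) ^+ (p.+1 + i) * (f0 p * g p i.+1).
  have pn : (p <= n)%N by rewrite -ltnS.
  have bn i : (i <= n - p)%N -> (p + i <= n)%N.
    by move=> ip; rewrite -leq_subRL.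
  have -> : n.+2 = (p.+1 + (n - p).+1)%N by rewrite addSn addnS subnKC.
  rewrite big_split_ord /=; congr (_ + _); apply: eq_bigr => i _.
    rewrite !face_face //; last by move=> j jp; apply: leq_trans pn.
    congr (_ * (_ * _)); congr (b _ _); apply: eq_face => j _ /=.
    have ip : (i <= p)%N by rewrite -ltnS.
    by rewrite /bump (leq_trans ip) ?leq_addr // add1n addSn.
  rewrite !face_face //; last by move=> j jp; apply: leq_trans pn.
  congr (_ * (_ * _)).
    congr (a _ _); apply: eq_face => j jp /=.
    by rewrite /bump leqNgt ltnS (leq_trans jp) ?leq_addr.
  congr (b _ _); apply: eq_face => j _ /=.
  by rewrite /bump addSnnS leq_add2l addnCA.
transitivity (\sum_(p < n.+1) (\sum_(i < p.+1) (-1) ^+ i * (f p i * g0 p) +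
  \sum_(i < (n - p).+1) (-1) ^+ (p.+1 + i) * (f0 p * g p i.+1))).
  rewrite /= /cup_fun; under eq_bigr do rewrite mulr_sumr.
  by rewrite exchange_big; apply: eq_bigr => p _; rewrite -fgE.
transitivity (\sum_(p < n.+1)
    ((\sum_(i < p.+2) (-1) ^+ i * f p i) * g0 p +
     (-1) ^+ p * f0 p * (\sum_(i < (n - p).+2) (-1) ^+ i * g p i))).
  apply: eq_bigr => p _; rewrite [in RHS]big_ord_recr mulrDl /= ffl.
  rewrite [X in _ = _ + _ * X]big_ord_recl mulrDr /= g00 expr0 mul1r.
  rewrite -!addrA; congr (_ + _).
    by rewrite mulr_suml; apply: eq_bigr => i _; rewrite mulrA.
  rewrite addrA exprS mulN1r !mulNr addNr add0r mulr_sumr.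
  apply: eq_bigr => i _; rewrite exprD !exprS.
  by rewrite !mulN1r !mulNr mulrN -!mulrA (mulrCA (f0 p)).
rewrite big_split; congr (_ + _).
  pose t q := delta a q (face q id s) *
    b (n.+1 - q)%N (face (n.+1 - q) (addn q) s).
  rewrite -[RHS]/(\sum_(q < n.+2) t q) [RHS]big_ord_recl /= [t 0%N]mul0r add0r.
  apply: eq_bigr => p _; rewrite -[RHS]/(t p.+1) /t subSS.
  congr (_ * _); apply: eq_bigr => i _; rewrite face_face // => j jp.
  by apply: (@leq_add _ _ 1 p); rewrite ?leq_b1.
pose t q := sign_involution a q (face q id s) *
  delta b (n.+1 - q)%N (face (n.+1 - q) (addn q) s).
rewrite -[RHS]/(\sum_(q < n.+2) t q) [RHS]big_ord_recr /= [t n.+1](_ : _ = 0) ?addr0;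
  last by rewrite /t subnn mulr0.
apply: eq_bigr => p _; rewrite /t subSn; last by rewrite -ltnS.
congr (_ * _); apply: eq_bigr => i _; rewrite face_face // => j jp.
by apply: (@leq_add _ _ 1 (n - p)); rewrite ?leq_b1.
Qed.

Lemma delta1 : delta 1 = 0.
Proof.
apply: cochainP => -[//|[|n]] s /=.
  by rewrite !big_ord_recl big_ord0 /= expr0 expr1 !mulr1 addr0 subrr.
by apply: big1 => i _; rewrite mulr0.
Qed.

Definition cocycles : {pred cochain} := fun a => delta a == 0.

Fact cocycles_subring_closed : subring_closed cocycles.
Proof.
split=> [|a b /eqP a0 /eqP b0|a b /eqP a0 /eqP b0]; apply/eqP.
- exact: delta1.
- by rewrite raddfB /= a0 b0 subrr.
- by rewrite delta_cup a0 b0 mul0r mulr0 addr0.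
Qed.
HB.instance Definition _ :=
  GRing.isSubringClosed.Build cochain cocycles cocycles_subring_closed.

Record cocycle := Cocycle { cocycle_val : cochain; _ : cocycle_val \in cocycles }.
HB.instance Definition _ := [isSub for cocycle_val].
HB.instance Definition _ := [Choice of cocycle by <:].
HB.instance Definition _ := GRing.SubChoice_isSubPzRing.Build cochain cocycles
  cocycle cocycles_subring_closed.

Lemma delta_cocycle (z : cocycle) : delta (val z) = 0.
Proof. exact/eqP/(valP z). Qed.

Definition coboundaries : {pred cocycle} :=
  fun z => `[< exists c, val z = delta c >].

Lemma coboundariesP (z : cocycle) :
  reflect (exists c, val z = delta c) (z \in coboundaries).
Proof. exact: asboolP. Qed.

Fact coboundaries_zmod_closed : zmod_closed coboundaries.
Proof.
split=> [|y z /coboundariesP[c yc] /coboundariesP[d zd]]; apply/coboundariesP.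
  by exists 0; rewrite !raddf0.
by exists (c - d); rewrite !raddfB /= yc zd.
Qed.
HB.instance Definition _ :=
  GRing.isZmodClosed.Build cocycle coboundaries coboundaries_zmod_closed.

Lemma coboundaries_mull (y z : cocycle) :
  z \in coboundaries -> y * z \in coboundaries.
Proof.
move=> /coboundariesP[c zc]; apply/coboundariesP; exists (sign_involution (val y) * c).
have s0 : sign_involution 0 = 0 by apply: cochainP => n s /=; rewrite mulr0.
by rewrite rmorphM /= zc delta_cup delta_sign delta_cocycle sign_involutionK
  s0 oppr0 mul0r add0r.
Qed.

Lemma coboundaries_mulr (y z : cocycle) :
  z \in coboundaries -> z * y \in coboundaries.
Proof.
move=> /coboundariesP[c zc]; apply/coboundariesP; exists (c * val y).
by rewrite rmorphM /= zc delta_cup delta_cocycle mulr0 addr0.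
Qed.

(* A family is a cocycle or a coboundary iff it is one in each degree, so this
   is the total cohomology H^*(X; K), the direct sum of the H^n(X; K). *)
Definition cohomology : Type := {ideal_quot coboundaries}.
HB.instance Definition _ := GRing.Zmodule.on cohomology.
HB.instance Definition _ := EqQuotient.on cohomology.

Definition cohomology_one : cohomology := \pi_cohomology 1.
Definition cohomology_mul (x y : cohomology) : cohomology :=
  \pi_cohomology (repr x * repr y).

Lemma pi_cup (y z : cocycle) :
  cohomology_mul (\pi_cohomology y) (\pi_cohomology z) = \pi_cohomology (y * z).
Proof.
have pirepr (x : cocycle) : repr (\pi_cohomology x) - x \in coboundaries.
  by rewrite Quotient.idealrBE reprK.
apply/eqP; rewrite -[_ == _]Quotient.idealrBE.
set y' := repr _; set z' := repr _.
have -> : y' * z' - y * z = (y' - y) * z' + y * (z' - z).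
  by rewrite mulrBl mulrBr addrA subrK.
by apply: rpredD; [apply: coboundaries_mulr | apply: coboundaries_mull];
  exact: pirepr.
Qed.

Fact cohomology_mulA : associative cohomology_mul.
Proof.
move=> x y z; rewrite -[x]reprK -[y]reprK -[z]reprK.
rewrite (pi_cup (repr x) (repr y)) (pi_cup (repr y) (repr z)).
by rewrite (pi_cup (repr x)) (pi_cup _ (repr z)) mulrA.
Qed.
Fact cohomology_mul1 : left_id cohomology_one cohomology_mul.
Proof. by move=> x; rewrite -[x]reprK pi_cup mul1r. Qed.
Fact cohomology_mulr1 : right_id cohomology_one cohomology_mul.
Proof. by move=> x; rewrite -[x]reprK pi_cup mulr1. Qed.
Fact cohomology_mulDl : left_distributive cohomology_mul +%R.
Proof.
move=> x y z; rewrite -[x]reprK -[y]reprK -[z]reprK -raddfD.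
rewrite (pi_cup _ (repr z)) (pi_cup (repr x) (repr z)) (pi_cup (repr y)).
by rewrite mulrDl raddfD.
Qed.
Fact cohomology_mulDr : right_distributive cohomology_mul +%R.
Proof.
move=> x y z; rewrite -[x]reprK -[y]reprK -[z]reprK -raddfD.
rewrite (pi_cup (repr x)) (pi_cup (repr x) (repr y)) (pi_cup (repr x)).
by rewrite mulrDr raddfD.
Qed.

HB.instance Definition _ := GRing.Zmodule_isPzRing.Build cohomology
  cohomology_mulA cohomology_mul1 cohomology_mulr1
  cohomology_mulDl cohomology_mulDr.

Lemma pi_cohomologyM (y z : cocycle) :
  \pi_cohomology (y * z) = \pi_cohomology y * \pi_cohomology z.
Proof. exact/esym/pi_cup. Qed.

End Cohomology.

Arguments cocycle R K X : clear implicits.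
Arguments cohomology R K X : clear implicits.

Section Functoriality.
Context {R : realType} {K : comPzRingType} {X Y : topologicalType}.
Variable f : continuousType X Y.

Fact pullback_bounded (c : cochain R K Y) :
  bounded_family (fun n (s : singular R n X) => c n (f \o s)).
Proof. by have [N cN] := cochain_bounded c; exists N => n s /cN->. Qed.

Definition pullback (c : cochain R K Y) : cochain R K X :=
  Cochain (pullback_bounded c).

Lemma face_comp n m (h : nat -> nat) (s : singular R n X) :
  f \o face m h s = face m h (f \o s) :> singular R m Y.
Proof. exact/continuousEP. Qed.

Fact pullback_is_zmod_morphism : zmod_morphism pullback.
Proof. by move=> a b; apply: cochainP. Qed.
HB.instance Definition _ := GRing.isZmodMorphism.Build
  (cochain R K Y) (cochain R K X) pullback pullback_is_zmod_morphism.

Fact pullback_is_monoid_morphism : monoid_morphism pullback.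
Proof.
split=> [|a b]; first exact: cochainP.
by apply: cochainP => n s; apply: eq_bigr => p _; rewrite /= !face_comp.
Qed.
HB.instance Definition _ := GRing.isMonoidMorphism.Build
  (cochain R K Y) (cochain R K X) pullback pullback_is_monoid_morphism.

Lemma delta_pullback (c : cochain R K Y) :
  delta (pullback c) = pullback (delta c).
Proof.
apply: cochainP => -[//|n] s; apply: eq_bigr => i _.
by rewrite /= face_comp.
Qed.

Fact pullback_cocycle (z : cocycle R K Y) : pullback (val z) \in cocycles.
Proof. by apply/eqP; rewrite delta_pullback delta_cocycle raddf0. Qed.

Definition cocycle_pullback (z : cocycle R K Y) : cocycle R K X :=
  Cocycle (pullback_cocycle z).

Definition cohomology_map (x : cohomology R K Y) : cohomology R K X :=
  \pi_(cohomology R K X) (cocycle_pullback (repr x)).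

Lemma cohomology_map_pi (z : cocycle R K Y) :
  cohomology_map (\pi_(cohomology R K Y) z) =
  \pi_(cohomology R K X) (cocycle_pullback z).
Proof.
apply/eqP; rewrite -[_ == _]Quotient.idealrBE; apply/coboundariesP.
have : repr (\pi_(cohomology R K Y) z) - z \in coboundaries.
  by rewrite Quotient.idealrBE reprK.
move=> /coboundariesP[c zc]; exists (pullback c).
by rewrite delta_pullback -zc !raddfB.
Qed.

Fact cohomology_map_is_zmod_morphism : zmod_morphism cohomology_map.
Proof.
move=> x y; rewrite -[x]reprK -[y]reprK -raddfB !cohomology_map_pi -raddfB.
by congr \pi; apply: val_inj; rewrite /= !raddfB.
Qed.
HB.instance Definition _ := GRing.isZmodMorphism.Build
  (cohomology R K Y) (cohomology R K X)
  cohomology_map cohomology_map_is_zmod_morphism.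

Fact cohomology_map_is_monoid_morphism : monoid_morphism cohomology_map.
Proof.
split=> [|x y].
  by rewrite cohomology_map_pi; congr \pi; apply: val_inj; rewrite /= rmorph1.
rewrite -[x]reprK -[y]reprK -pi_cohomologyM !cohomology_map_pi -pi_cohomologyM.
by congr \pi; apply: val_inj; rewrite /= rmorphM.
Qed.
HB.instance Definition _ := GRing.isMonoidMorphism.Build
  (cohomology R K Y) (cohomology R K X)
  cohomology_map cohomology_map_is_monoid_morphism.

End Functoriality.

Section Genus.
Context {E B : topologicalType} (f : E -> B).

Definition has_section_on (U : set B) : Prop :=
  exists s : U -> E, continuous s /\ forall u, f (s u) = val u.

Definition sectional_cover (k : nat) : Prop :=
  exists U : 'I_k -> set B,
    [/\ forall i, open (U i), \bigcup_i U i = setT &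
        forall i, has_section_on (U i)].

(* The unreduced convention: k counts the open sets, with no shift by one. *)
Definition genus (R : realType) : \bar R :=
  if pselect (exists k, `[< sectional_cover k >]) is left ex_k
  then (ex_minn ex_k)%:R%:E else +oo%E.

End Genus.

Section RelativeTC.
Context (R : realType) {X : topologicalType} (Y : set X).

Definition unit_interval : set R := `[0, 1].

Fact unit_interval0 : 0 \in unit_interval.
Proof. by rewrite inE /unit_interval /= in_itv /= lexx ler01. Qed.
Fact unit_interval1 : 1 \in unit_interval.
Proof. by rewrite inE /unit_interval /= in_itv /= lexx ler01. Qed.
Definition I0 : unit_interval := exist _ 0 unit_interval0.
Definition I1 : unit_interval := exist _ 1 unit_interval1.

(* P_(X x Y), with the subspace topology of the compact-open topology. *)
Definition path_space : set {compact-open, unit_interval -> X} :=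
  [set g | continuous (g : unit_interval -> X) /\ Y (g I1)].

Fact path_space_end (g : path_space) : val g I1 \in Y.
Proof. by apply/mem_set; case: (set_mem (valP g)). Qed.

Definition endpoints (g : path_space) : X * Y :=
  (val g I0, exist _ (val g I1) (path_space_end g)).

Definition TC : \bar R := genus endpoints R.

End RelativeTC.

Section ZeroDivisors.
Context {X : topologicalType} (Y : set X).

Definition relative_diagonal (y : Y) : X * Y := (val y, y).

Fact relative_diagonal_continuous : continuous relative_diagonal.
Proof.
move=> y; apply: (@cvg_pair _ _ _ _ (nbhs (val y)) (nbhs y)).
- exact: (nbhs_filter y).
- exact: (@initial_continuous Y X set_val).
- exact: cvg_id.
Qed.
HB.instance Definition _ :=
  @isContinuous.Build Y (X * Y)%type relative_diagonal relative_diagonal_continuous.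

Definition zero_divisors (R : realType) (K : comPzRingType)
  : set (cohomology R K (X * Y)%type) :=
  [set x | cohomology_map relative_diagonal x = 0].

End ZeroDivisors.

(* Main.v *)
Require Import Defs.
From HB Require Import structures.
From mathcomp Require Import all_boot all_order all_algebra.
From mathcomp Require Import all_classical all_reals all_analysis.
Set Implicit Arguments.
Unset Strict Implicit.
Unset Printing Implicit Defensive.
Import Order.TTheory GRing.Theory Num.Theory.
Import numFieldNormedType.Exports.
Local Open Scope classical_set_scope.
Local Open Scope ring_scope.

(** Suppose that [TC(X, Y) <= k], so that [X * Y] is covered by open sets
    [U_1, ..., U_k] (some of them possibly empty) with sections of the endpoint
    map.  Such a section deforms the inclusion of [U_i] into the map
    [(x, y) |-> (y, y)], which factors through the diagonal of [Y]; by homotopy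
    invariance a zero-divisor restricts to 0 on [U_i]
    ([zero_divisors_restrict]).  Correcting a cocycle by the coboundary of a
    cochain extended by zero, the class [alpha_i] is represented by a cocycle that
    vanishes identically on the singular simplices contained in [U_i]
    ([representative_vanishing_on]).  Every singular simplex contained in some
    [U_i] then kills the cup product of these representatives, as each of its
    faces lies in [U_i] too.  A cocycle that vanishes on the simplices subordinate
    to an open cover is a coboundary ([small_cocycle_coboundary]), so the product
    of the [alpha_i] is 0.

    Both homotopy invariance and the statement on small simplices come from one
    combinatorial construction: the prism over an ordered simplex, subdivided
    barycentrically at the bottom and unchanged at the top ([prism],
    [prism_homotopy]).  It is built by iterated cones on formal sequences of
    vertices, and transported to singular cochains by evaluating them on affine
    simplices.  Used with a homotopy [H], it shows that [H_1^* z] is cohomologous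
    to the subdivision of [H_0^* z]; used with a constant homotopy, that
    subdivision does not change cohomology classes.  Finally iterated subdivisions
    become arbitrarily fine ([sd_vanish]), so the existence of a Lebesgue number
    shows that every simplex is eventually subdivided into small ones
    ([iter_subdivision_vanish]). *)

(** * Cochains on the ordered simplices of a full simplex *)

Section FullSimplex.
Context {K : zmodType}.

(** A function on finite sequences of vertices is a cochain of the full simplex
    on [V], a sequence of length [n] being an ordered simplex of dimension
    [n - 1]; [bd] is the augmented coboundary, that is, the alternating sum over
    all the ways of omitting one vertex.  The recursion says that the boundary of
    the cone [v * s] is [s] minus the cone over the boundary of [s]: this is the
    only form in which the coboundary enters the cone constructions below. *)
Fixpoint bd {V} (phi : seq V -> K) (s : seq V) : K :=
  if s is v :: s' then phi s' - bd (fun t => phi (v :: t)) s' else 0.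

Lemma eq_bd V (phi psi : seq V -> K) s :
  (forall t, (size t).+1 = size s -> phi t = psi t) -> bd phi s = bd psi s.
Proof.
elim: s phi psi => [//|v s IH] phi psi E /=; rewrite E //; congr (_ - _).
by apply: IH => t ts; apply: E; rewrite /= ts.
Qed.

Lemma bd0 V (s : seq V) : bd (fun=> 0) s = 0.
Proof. by elim: s => //= v s ->; rewrite subr0. Qed.

Lemma bdB V (phi psi : seq V -> K) s :
  bd (fun t => phi t - psi t) s = bd phi s - bd psi s.
Proof.
elim: s phi psi => [|v s IH] phi psi /=; first by rewrite subr0.
by rewrite (IH (fun t => phi (v :: t))) opprD addrACA -opprD.
Qed.

Lemma bd_map V W (f : V -> W) (phi : seq W -> K) s :
  bd (fun t => phi (map f t)) s = bd phi (map f s).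
Proof.
elim: s phi => //= v s IH phi; congr (_ - _).
exact: (IH (fun t => phi (f v :: t))).
Qed.

Lemma bd_bd V (phi : seq V -> K) s : bd (bd phi) s = 0.
Proof.
elim: s phi => //= v s IH phi.
by rewrite (bdB phi) IH subr0 subrr.
Qed.

Context {V : Type} (b : seq V -> V).

(** Barycentric subdivision, dually: the subdivision of [s] is the cone with
    apex [b s] over the subdivision of the boundary of [s].  The first argument
    is the number of vertices of [s]. *)
Fixpoint sd n (phi : seq V -> K) (s : seq V) : K :=
  if n is n'.+1 then bd (sd n' (fun t => phi (b s :: t))) s else phi s.

Definition top (v : V) := (v, true).
Definition bot (v : V) := (v, false).

Lemma map_fst_top s : map fst (map top s) = s.
Proof. by elim: s => //= v s ->. Qed.
Lemma map_fst_bot s : map fst (map bot s) = s.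
Proof. by elim: s => //= v s ->. Qed.
Lemma map_snd_top s : map snd (map top s) = nseq (size s) true.
Proof. by elim: s => //= v s ->. Qed.
Lemma map_snd_bot s : map snd (map bot s) = nseq (size s) false.
Proof. by elim: s => //= v s ->. Qed.

(** The standard triangulation of the product of [s] with the unit interval that
    is barycentrically subdivided at the bottom and left alone at the top: the
    cone, with apex the barycenter of the bottom, over the top face and the walls.
    Vertices carry the boolean telling whether they lie at the top.  A single
    construction thus compares the two ends of a homotopy up to subdivision, and
    subdivision with the identity. *)
Fixpoint prism n (phi : seq (V * bool) -> K) (s : seq V) : K :=
  if n is n'.+1 then
    phi (bot (b s) :: map top s) -
      bd (prism n' (fun t => phi (bot (b s) :: t))) s
  else 0.

Lemma eq_prism n phi psi s : size s = n ->
  (forall t, size t = n.+1 -> phi t = psi t) -> prism n phi s = prism n psi s.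
Proof.
elim: n phi psi s => //= n IH phi psi s sn E.
rewrite E /= ?size_map ?sn //; congr (_ - _); apply: eq_bd => t; rewrite sn => -[tn].
by apply: IH => // u un; apply: E; rewrite /= un.
Qed.

Lemma eq_sd n phi psi s : size s = n ->
  (forall t, size t = n -> phi t = psi t) -> sd n phi s = sd n psi s.
Proof.
elim: n phi psi s => [|n IH] phi psi s sn E /=; first exact: E.
apply: eq_bd => t; rewrite sn => -[tn].
by apply: IH => // u un; apply: E; rewrite /= un.
Qed.

Lemma sd0 n s : sd n (fun=> 0) s = 0.
Proof.
elim: n s => //= n IH s; rewrite (_ : sd n _ = fun=> 0) ?bd0 //.
exact/funext.
Qed.

Lemma sdB n phi psi s :
  sd n (fun t => phi t - psi t) s = sd n phi s - sd n psi s.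
Proof.
elim: n phi psi s => //= n IH phi psi s; rewrite -bdB; congr bd.
by apply/funext => t; rewrite IH.
Qed.

Lemma prism0 n s : prism n (fun=> 0) s = 0.
Proof.
elim: n s => //= n IH s; rewrite sub0r (_ : prism n _ = fun=> 0) ?bd0 ?oppr0 //.
exact/funext.
Qed.

Lemma prismB n phi psi s :
  prism n (fun t => phi t - psi t) s = prism n phi s - prism n psi s.
Proof.
elim: n phi psi s => [|n IH] phi psi s /=; first by rewrite subr0.
set c := bot _.
rewrite (_ : prism n _ = fun t => prism n (fun u => phi (c :: u)) t -
                                  prism n (fun u => psi (c :: u)) t).
  by rewrite bdB opprD addrACA -opprD.
by apply/funext => t; rewrite -IH.
Qed.

(** The boundary of a cone is its base minus the cone over the boundary of the
    base.  Here the base consists of the top face and the walls; by induction its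
    boundary is the subdivided boundary of the bottom face, over which the cone
    is the subdivided bottom face. *)
Lemma prism_homotopy n phi s : size s = n ->
  prism n (bd phi) s + bd (prism n.-1 phi) s =
  phi (map top s) - sd n (fun t => phi (map bot t)) s.
Proof.
elim: n phi s => [|n IH] phi s sn /=; first by rewrite (size0nil sn) /= addr0 subrr.
(* phic is phi on cones with apex c: bd phi (c :: t) = phi t - bd phic t. *)
set c := bot (b s); pose phic t := phi (c :: t).
rewrite -/phic.
rewrite (_ : prism n _ = fun t => prism n phi t - prism n (bd phic) t); last first.
  by apply/funext => t; rewrite -prismB.
rewrite bdB.
have -> : bd (prism n (bd phic)) s =
    bd (fun t => phic (map top t) - sd n (fun t => phic (map bot t)) t -
      bd (prism n.-1 phic) t) s.
  apply: eq_bd => t; rewrite sn => -[tn].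
  by rewrite -IH // addrK.
rewrite !bdB bd_bd subr0 bd_map.
by rewrite opprB addrA subrK addrA subrK.
Qed.

End FullSimplex.

(** An affine map commutes with barycenters, hence carries the subdivision and
    the prism of a simplex to those of its image. *)
Section FullSimplexMap.
Context {K : zmodType} {V W : Type} (b : seq V -> V) (b' : seq W -> W) (f : V -> W).
Hypothesis fb : forall s, (0 < size s)%N -> b' (map f s) = f (b s).

Lemma sd_map n (phi : seq W -> K) s : size s = n ->
  sd b n (fun t => phi (map f t)) s = sd b' n phi (map f s).
Proof.
elim: n phi s => //= n IH phi s sn.
rewrite -bd_map fb ?sn //; apply: eq_bd => t; rewrite sn => -[tn].
by rewrite -IH.
Qed.

Lemma prism_map n (phi : seq (W * bool) -> K) s : size s = n ->
  prism b n (fun t => phi [seq (f v.1, v.2) | v <- t]) s =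
  prism b' n phi (map f s).
Proof.
elim: n phi s => //= n IH phi s sn.
rewrite fb ?sn // -bd_map -!map_comp; congr (_ - _).
apply: eq_bd => t; rewrite sn => -[tn].
by rewrite -IH.
Qed.

End FullSimplexMap.

Definition omit {V} i (s : seq V) := take i s ++ drop i.+1 s.

Lemma size_omit V i (s : seq V) : (i < size s)%N -> (size (omit i s)).+1 = size s.
Proof.
move=> i_s; rewrite size_cat size_take_min size_drop (minn_idPl (ltnW i_s)).
by rewrite -addnS subnSK // subnKC // ltnW.
Qed.

Lemma nth_omit V x0 i (s : seq V) j : nth x0 (omit i s) j = nth x0 s (bump i j).
Proof.
elim: s i j => [|v s IH] i j; first by rewrite /omit !nth_nil.
case: i j => [|i] [|j]; try by rewrite /omit /= ?drop0.
by rewrite bumpS; exact: IH.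
Qed.

Lemma bdE (K : pzRingType) V (phi : seq V -> K) s :
  bd phi s = \sum_(i < size s) (-1) ^+ i * phi (omit i s).
Proof.
elim: s phi => [|v s IH] phi /=; first by rewrite big_ord0.
rewrite big_ord_recl expr0 mul1r /omit /= drop0; congr (_ + _).
rewrite IH -sumrN; apply: eq_bigr => i _.
by rewrite exprS mulN1r mulNr.
Qed.

Lemma map_omit V W (f : V -> W) i s : map f (omit i s) = omit i (map f s).
Proof. by rewrite map_cat map_take map_drop. Qed.

(** * Affine singular simplices *)

Lemma ltn_bump k m (i : 'I_m.+1) : (bump k i < m.+2)%N.
Proof. exact: (@leq_add _ _ 1 m (leq_b1 _) (ltn_ord i)). Qed.

Section AffineSimplices.
Context {R : realType}.

Lemma simplex_ge0 n (t : std_simplex R n) i : 0 <= val t 0 i.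
Proof. by case: t => t /=; rewrite inE => -[]. Qed.

Lemma simplex_sum1 n (t : std_simplex R n) : \sum_i val t 0 i = 1.
Proof. by case: t => t /=; rewrite inE => -[]. Qed.

Fact vertex_subproof n i : delta_mx 0 (inord i) \in std_simplex R n.
Proof.
rewrite inE; split => [j|]; first by rewrite mxE; case: (_ && _).
rewrite (bigD1 (inord i)) //= mxE !eqxx big1 ?addr0 // => j ji.
by rewrite mxE (negbTE ji) andbF.
Qed.

Definition vertex n i : std_simplex R n := exist _ (delta_mx 0 (inord i)) (vertex_subproof n i).
Definition vertices n : seq (std_simplex R n) := mkseq (vertex n) n.+1.

Lemma size_vertices n : size (vertices n) = n.+1.
Proof. exact: size_mkseq. Qed.

Definition combination (V : lmodType R) p (v : nat -> V) (t : 'rV[R]_p.+1) : V :=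
  \sum_(i < p.+1) t 0 i *: v i.

Lemma combination_continuous (V : normedModType R) p (v : nat -> V) :
  continuous (combination v : 'rV[R]_p.+1 -> V).
Proof.
move=> t; apply: (cvg_big (F := nbhs t) add_continuous) => i _.
by apply: cvgZr_tmp; exact: coord_continuous.
Qed.

Lemma combination_simplex n p (s : seq (std_simplex R n)) (t : std_simplex R p) :
  combination (fun i => val (nth (vertex n 0) s i)) (val t) \in std_simplex R n.
Proof.
rewrite inE; split => [j|].
  by rewrite summxE sumr_ge0 // => i _; rewrite mxE mulr_ge0 ?simplex_ge0.
under eq_bigr do rewrite summxE.
rewrite exchange_big -[RHS](simplex_sum1 t); apply: eq_bigr => i _ /=.
by under eq_bigr do rewrite mxE; rewrite -mulr_sumr simplex_sum1 mulr1.
Qed.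

(** The default value of [nth] makes this total in [s], but it is the affine
    simplex with vertices [s] only when [size s = p.+1]. *)
Definition affine n p (s : seq (std_simplex R n)) (t : std_simplex R p)
  : std_simplex R n := exist _ (combination _ _) (combination_simplex s t).

Lemma affine_continuous n p (s : seq (std_simplex R n)) :
  continuous (affine s : std_simplex R p -> _).
Proof.
apply: (@continuous_comp_initial _ _ _ set_val) => t.
apply: (@continuous_comp _ _ _ set_val
  (combination (fun i => val (nth (vertex n 0) s i)))).
  exact: initial_continuous.
exact: combination_continuous.
Qed.

HB.instance Definition _ n p (s : seq (std_simplex R n)) :=
  @isContinuous.Build _ _ (affine s) (@affine_continuous n p s).

Lemma affine_affine n p q (g : seq (std_simplex R n)) (s : seq (std_simplex R p))
    (t : std_simplex R q) : size s = q.+1 ->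
  affine g (affine s t) = affine (map (affine g) s) t.
Proof.
move=> sq; apply: val_inj; rewrite /= /combination.
under eq_bigr do rewrite summxE scaler_suml.
rewrite exchange_big; apply: eq_bigr => i _ /=.
rewrite (nth_map (vertex p 0)) ?sq //= /combination scaler_sumr.
by apply: eq_bigr => j _; rewrite mxE scalerA.
Qed.

Lemma affine_vertex n p (g : seq (std_simplex R n)) i : (i <= p)%N ->
  affine g (vertex p i) = nth (vertex n 0) g i.
Proof.
move=> ip; apply: val_inj; rewrite /= /combination (bigD1 (inord i)) //=.
rewrite mxE !eqxx scale1r inordK // big1 ?addr0 // => j ji.
by rewrite mxE (negbTE ji) andbF scale0r.
Qed.

Lemma map_affine_vertices n p (g : seq (std_simplex R n)) :
  size g = p.+1 -> map (affine g) (vertices p) = g.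
Proof.
move=> gp; apply: (@eq_from_nth _ (vertex n 0)); rewrite size_map size_vertices //.
move=> i ip; rewrite (nth_map (vertex p 0)) ?size_vertices // nth_mkseq //.
exact: affine_vertex.
Qed.

Lemma affine_vertices p (t : std_simplex R p) : affine (vertices p) t = t.
Proof.
apply: val_inj; rewrite /= /combination [RHS]row_sum_delta.
by apply: eq_bigr => i _; rewrite nth_mkseq //= inord_val.
Qed.

Lemma face_affine m k (t : std_simplex R m) : (k <= m.+1)%N ->
  vertex_map (fun i : 'I_m.+1 => inord (bump k i) : 'I_m.+2) t =
  affine (omit k (vertices m.+1)) t.
Proof.
move=> km; apply: val_inj; apply/rowP => j; rewrite /= /combination mxE summxE.
rewrite big_mkcond; apply: eq_bigr => i _; rewrite nth_omit nth_mkseq.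
  by rewrite !mxE /= eq_sym; case: eqP; rewrite ?mulr1 ?mulr0.
exact: ltn_bump.
Qed.

Definition center p : std_simplex R p.
exists (const_mx p.+1%:R^-1); rewrite inE; split => [i|].
  by rewrite mxE invr_ge0.
under eq_bigr do rewrite mxE.
by rewrite sumr_const card_ord -[_ *+ _]mulr_natl mulfV ?pnatr_eq0.
Defined.

Definition barycenter n (s : seq (std_simplex R n)) : std_simplex R n :=
  affine s (center (size s).-1).

Lemma barycenter_map n p (g : seq (std_simplex R n)) (s : seq (std_simplex R p)) :
  (0 < size s)%N -> barycenter (map (affine g) s) = affine g (barycenter s).
Proof.
by move=> s0; rewrite /barycenter affine_affine ?size_map // prednK.
Qed.

(** The affine function with value 1 at the vertices labelled [true] and 0 at
    the others. *)
Definition weight p (l : seq bool) (t : 'rV[R]_p.+1) : R :=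
  combination (fun i => (nth false l i)%:R : R^o) t.

Lemma weight_unit p l (t : std_simplex R p) : weight l (val t) \in @unit_interval R.
Proof.
rewrite inE /unit_interval /= in_itv /= /weight /combination; apply/andP; split.
  by rewrite sumr_ge0 // => i _; rewrite mulr_ge0 ?simplex_ge0.
rewrite -[leRHS](simplex_sum1 t); apply: ler_sum => i _ /=.
by rewrite /GRing.scale/= ler_piMr ?simplex_ge0 ?lern1 ?leq_b1.
Qed.

Definition height p l (t : std_simplex R p) : @unit_interval R :=
  exist _ (weight _ _) (weight_unit l t).

Lemma height_continuous p l : continuous (height l : std_simplex R p -> _).
Proof.
apply: (@continuous_comp_initial _ _ _ set_val) => t.
apply: (@continuous_comp _ _ _ set_val (weight l)).
  exact: initial_continuous.
exact: combination_continuous.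
Qed.

HB.instance Definition _ p l :=
  @isContinuous.Build _ _ (height l) (@height_continuous p l).

Lemma height_face m k l (t : std_simplex R m) : (k <= m.+1)%N ->
  height l (affine (omit k (vertices m.+1)) t) = height (omit k l) t.
Proof.
move=> km; apply: val_inj; rewrite /= /weight /combination.
under eq_bigr do rewrite summxE scaler_suml.
rewrite exchange_big; apply: eq_bigr => i _ /=.
rewrite !nth_omit nth_mkseq; last first.
  exact: ltn_bump.
rewrite (bigD1 (inord (bump k i))) //= !mxE !eqxx mulr1 big1 ?addr0 ?inordK //.
  exact: ltn_bump.
by move=> j ji; rewrite !mxE (negbTE ji) mulr0 scale0r.
Qed.

Lemma height_nseq p b (t : std_simplex R p) :
  height (nseq p.+1 b) t = if b then I1 R else I0 R.
Proof.
apply: val_inj; transitivity (\sum_(i < p.+1) val t 0 i *: (b%:R : R^o)).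
  by apply: eq_bigr => i _; rewrite nth_nseq ltn_ord.
by rewrite -scaler_suml simplex_sum1 scale1r; case: b.
Qed.

End AffineSimplices.

Arguments barycenter {R n} s.

(** * The prism operator and subdivision on singular cochains *)

Section Pairing.
Context {T X Y : topologicalType} (f : continuousType T X) (g : continuousType T Y).

Definition pairing (t : T) : X * Y := (f t, g t).

Fact pairing_continuous : continuous pairing.
Proof.
move=> t; apply: (@cvg_pair _ _ _ _ (nbhs (f t)) (nbhs (g t))).
- exact: cts_fun.
- exact: cts_fun.
Qed.
HB.instance Definition _ := @isContinuous.Build T (X * Y)%type pairing pairing_continuous.

End Pairing.

Section PrismOperator.
Context {R : realType} {K : comPzRingType} {X Z : topologicalType}.
Variable H : continuousType (X * @unit_interval R)%type Z.

(** The affine simplex of the prism over the standard simplex whose vertices, with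
    their levels, are listed in [l], carried to [Z] by [s * id] and [H]. *)
Definition prism_simplex n (s : singular R n X) p (l : seq (std_simplex R n * bool))
  : singular R p Z :=
  H \o pairing (s \o affine (map fst l)) (height (map snd l)).

(** The cochain [c] restricted to the affine simplices of the prism over [s]; the
    value 0 on the empty sequence makes the augmented coboundary agree with
    [delta] in degree 0. *)
Definition eval_prism (c : cochain R K Z) n (s : singular R n X) l : K :=
  if l is _ :: l' then c (size l') (prism_simplex s (size l') l) else 0.

Lemma eval_prismE c n (s : singular R n X) p l : size l = p.+1 ->
  eval_prism c s l = c p (prism_simplex s p l).
Proof. by case: l => // v l [<-]. Qed.

Lemma face_prism_simplex n (s : singular R n X) m k l :
  (k <= m.+1)%N -> size l = m.+2 ->
  face m (bump k) (prism_simplex s m.+1 l) = prism_simplex s m (omit k l).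
Proof.
move=> km lm; apply/continuousEP => t; rewrite /= face_affine // /pairing /=.
have ok : size (omit k (vertices m.+1 : seq (std_simplex R m.+1))) = m.+1.
  by apply/succn_inj; rewrite size_omit size_vertices.
rewrite height_face // affine_affine // !map_omit map_affine_vertices //.
by rewrite size_map.
Qed.

Lemma eval_prism_delta c n (s : singular R n X) l :
  eval_prism (delta c) s l = bd (eval_prism c s) l.
Proof.
rewrite bdE; case: l => [|v [|w l]]; first by rewrite big_ord0.
  by rewrite /= big_ord_recl big_ord0 mulr0 addr0.
apply: eq_bigr => i _; congr (_ * _).
rewrite (@eval_prismE _ _ _ (size l)); first by rewrite face_prism_simplex // -ltnS.
by apply/succn_inj; rewrite size_omit.
Qed.

Lemma eval_prism_affine c n p (s : singular R n X) (g : seq (std_simplex R n)) l :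
  eval_prism c (s \o affine g : singular R p X) l =
  eval_prism c s [seq (affine g v.1, v.2) | v <- l].
Proof.
case: l => // v l; rewrite /eval_prism /= size_map; congr (c _ _).
apply/continuousEP => t; congr (H (_, _)); last by rewrite /= -map_comp.
by rewrite /= affine_affine /= ?size_map // -!map_comp.
Qed.

Definition prism_fun (c : cochain R K Z) n (s : singular R n X) : K :=
  prism barycenter n.+1 (eval_prism c s) (vertices n).

Lemma prism_fun0 (c : cochain R K Z) n s :
  (forall t, c n.+1 t = 0) -> @prism_fun c n s = 0.
Proof.
move=> c0; rewrite /prism_fun (@eq_prism _ _ _ _ _ (fun=> 0)) ?size_vertices //.
  exact: prism0.
by move=> l ln; rewrite (eval_prismE _ _ ln).
Qed.

Fact prism_bounded (c : cochain R K Z) : bounded_family (prism_fun c).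
Proof.
have [N cN] := cochain_bounded c; exists N => n s Nn.
by apply: prism_fun0 => t; rewrite cN // leqW.
Qed.

Definition prism_cochain (c : cochain R K Z) : cochain R K X :=
  Cochain (prism_bounded c).

(** By naturality the prism over the [i]-th face of [s] is the prism, inside that
    over [s], over the [i]-th face of the standard simplex. *)
Lemma delta_prism_cochain c n (s : singular R n X) :
  delta (prism_cochain c) n s = bd (prism barycenter n (eval_prism c s)) (vertices n).
Proof.
case: n s => [|n] s; first by rewrite /= subr0.
rewrite bdE size_vertices; apply: eq_bigr => i _; congr (_ * _).
have gi : size (omit i (vertices n.+1 : seq (std_simplex R n.+1))) = n.+1.
  by apply/succn_inj; rewrite size_omit size_vertices.
rewrite -(map_affine_vertices gi) -(prism_map (b := barycenter)).
- congr (prism _ _ _ _); apply/funext => l.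
  rewrite -eval_prism_affine; congr eval_prism; apply/continuousEP => t.
  by rewrite /= face_affine // -ltnS.
- by move=> g; exact: barycenter_map.
- exact: size_vertices.
Qed.

End PrismOperator.

Section Subdivision.
Context {R : realType} {K : comPzRingType} {X : topologicalType}.
Implicit Types c : cochain R K X.

Definition eval_affine c n (s : singular R n X) (l : seq (std_simplex R n)) : K :=
  if l is _ :: l' then c (size l') (s \o affine l) else 0.

Lemma eval_affineE c n (s : singular R n X) p l : size l = p.+1 ->
  eval_affine c s l = c p (s \o affine l).
Proof. by case: l => // v l [<-]. Qed.

Definition subdivision_fun c n (s : singular R n X) : K :=
  sd barycenter n.+1 (eval_affine c s) (vertices n).

Lemma subdivision_fun0 c n s :
  (forall t, c n t = 0) -> @subdivision_fun c n s = 0.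
Proof.
move=> c0; rewrite /subdivision_fun (@eq_sd _ _ _ _ _ (fun=> 0)) ?size_vertices //.
  exact: sd0.
by move=> l ln; rewrite (eval_affineE _ _ ln).
Qed.

Fact subdivision_bounded c : bounded_family (subdivision_fun c).
Proof.
have [N cN] := cochain_bounded c; exists N => n s Nn.
by apply: subdivision_fun0 => t; rewrite cN.
Qed.

Definition subdivision c : cochain R K X := Cochain (subdivision_bounded c).

Fact subdivision_is_zmod_morphism : zmod_morphism subdivision.
Proof.
move=> c d; apply: cochainP => n s; rewrite /= /subdivision_fun -sdB.
by congr sd; apply/funext => -[|v l] //=; rewrite subr0.
Qed.
HB.instance Definition _ := GRing.isZmodMorphism.Build
  (cochain R K X) (cochain R K X) subdivision subdivision_is_zmod_morphism.

End Subdivision.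

(** [f0^* c] is subdivided because the bottom of the prism is. *)
Lemma prism_cochain_homotopy (R : realType) (K : comPzRingType)
    (X Z : topologicalType) (H : continuousType (X * @unit_interval R)%type Z)
    (f0 f1 : continuousType X Z) (c : cochain R K Z) :
  (forall x, H (x, I0 R) = f0 x) -> (forall x, H (x, I1 R) = f1 x) ->
  prism_cochain H (delta c) + delta (prism_cochain H c) =
  pullback f1 c - subdivision (pullback f0 c).
Proof.
move=> H0 H1; apply: cochainP => n s.
transitivity (prism barycenter n.+1 (bd (eval_prism H c s)) (vertices n) +
    bd (prism barycenter n (eval_prism H c s)) (vertices n)).
  rewrite -delta_prism_cochain; congr (prism _ _ _ _ + _).
  by apply/funext => l; rewrite eval_prism_delta.
rewrite prism_homotopy ?size_vertices //; congr (_ - _).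
  rewrite (@eval_prismE _ _ _ _ _ _ _ _ n) ?size_map ?size_iota //.
  congr (c _ _); apply/continuousEP => t.
  rewrite -[LHS]/(H (s (affine _ t), height _ t)) map_fst_top map_snd_top.
  by rewrite affine_vertices size_vertices height_nseq H1.
rewrite -[RHS]/(sd barycenter n.+1 (eval_affine (pullback f0 c) s) (vertices n)).
congr (sd _ _ _ _); apply/funext => -[//|v l].
rewrite (@eval_prismE _ _ _ _ _ _ _ _ (size l)) ?size_map //.
rewrite (@eval_affineE _ _ _ _ _ _ (size l)) //.
congr (c _ _); apply/continuousEP => t.
rewrite -[LHS]/(H (s (affine _ t), height _ t)) map_fst_bot map_snd_bot.
by rewrite height_nseq H0.
Qed.

(** * Homotopy invariance *)

Section Homotopy.
Context {R : realType} {K : comPzRingType}.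

Section SubdivisionPrism.
Context {X : topologicalType}.

Lemma fst_continuous (T1 T2 : topologicalType) : continuous (@fst T1 T2).
Proof. by move=> x; exact: cvg_fst. Qed.

(** For the constant homotopy, the prism operator becomes a chain homotopy
    between the identity and subdivision. *)
Definition subdivision_prism : cochain R K X -> cochain R K X :=
  prism_cochain (mkcts (@fst_continuous X (@unit_interval R))).

Lemma subdivision_homotopy (c : cochain R K X) :
  subdivision_prism (delta c) + delta (subdivision_prism c) = c - subdivision c.
Proof.
rewrite /subdivision_prism (prism_cochain_homotopy (f0 := idfun) (f1 := idfun)) //.
have -> : pullback idfun c = c :> cochain R K X; last by [].
by apply: cochainP => n s /=; congr (c _ _); exact/continuousEP.
Qed.

(** Any operator of the form [1 - (T d + d T)] commutes with [d]. *)
Lemma delta_subdivision (c : cochain R K X) :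
  delta (subdivision c) = subdivision (delta c).
Proof.
have E d : subdivision d = d - (subdivision_prism (delta d) + delta (subdivision_prism d)).
  by rewrite subdivision_homotopy opprB addrC subrK.
rewrite !E !raddfB !raddfD /= !delta_delta.
rewrite (_ : subdivision_prism 0 = 0) ?oppr0 ?addr0 ?add0r //.
by apply: cochainP => n s; exact: prism_fun0.
Qed.

End SubdivisionPrism.

(** Both [f1^* z] and [f0^* z] are cohomologous to the subdivision of [f0^* z]. *)
Lemma cohomology_map_homotopic (X Z : topologicalType)
    (H : continuousType (X * @unit_interval R)%type Z) (f0 f1 : continuousType X Z) :
  (forall x, H (x, I0 R) = f0 x) -> (forall x, H (x, I1 R) = f1 x) ->
  forall x : cohomology R K Z, cohomology_map f0 x = cohomology_map f1 x.
Proof.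
move=> H0 H1 x; rewrite -[x]reprK !cohomology_map_pi; set z := repr x.
apply/eqP; rewrite -[_ == _]Quotient.idealrBE; apply/coboundariesP.
exists (subdivision_prism (pullback f0 (val z)) - prism_cochain H (val z)).
have hH := prism_cochain_homotopy (val z) H0 H1.
have h0 := subdivision_homotopy (pullback f0 (val z)).
have P0 : prism_cochain H (0 : cochain R K Z) = 0.
  by apply: cochainP => n s; exact: prism_fun0.
have S0 : subdivision_prism (0 : cochain R K X) = 0.
  by apply: cochainP => n s; exact: prism_fun0.
move: hH h0; rewrite delta_pullback delta_cocycle raddf0 S0 P0 !add0r => hH h0.
by rewrite [RHS]raddfB /= hH h0 opprB addrA subrK.
Qed.

End Homotopy.

(** * The mesh of iterated subdivisions *)

Lemma sub_omit (V : eqType) i (s : seq V) : {subset omit i s <= s}.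
Proof. by move=> v; rewrite mem_cat => /orP[/mem_take|/mem_drop]. Qed.

Section Mesh.
Context {R : realType} {n : nat}.
Local Notation simplex := (std_simplex R n).
Implicit Types (s t : seq simplex) (x : 'rV[R]_n.+1) (r D : R).

Definition clustered s x r := forall u, u \in s -> `|val u - x| <= r.
Definition mesh_le s D := forall u, u \in s -> clustered s (val u) D.

Lemma affine_norm p s (t : std_simplex R p) x :
  `|val (affine s t) - x| <=
    \sum_(i < p.+1) val t 0 i * `|val (nth (vertex n 0) s i) - x|.
Proof.
have -> : val (affine s t) - x =
    \sum_(i < p.+1) val t 0 i *: (val (nth (vertex n 0) s i) - x).
  under eq_bigr do rewrite scalerBr.
  by rewrite sumrB -scaler_suml simplex_sum1 scale1r.
apply: le_trans (ler_norm_sum _ _ _) _; apply: ler_sum => i _.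
by rewrite normrZ ger0_norm // simplex_ge0.
Qed.

Lemma affine_within p s (t : std_simplex R p) x r : size s = p.+1 ->
  clustered s x r -> `|val (affine s t) - x| <= r.
Proof.
move=> sp sx; apply: le_trans (affine_norm _ _ _) _.
rewrite -[leRHS]mul1r -(simplex_sum1 t) mulr_suml; apply: ler_sum => i _.
by apply: ler_wpM2l; [exact: simplex_ge0|apply: sx; rewrite mem_nth ?sp].
Qed.

Lemma barycenter_within s x r : (0 < size s)%N -> clustered s x r ->
  `|val (barycenter s) - x| <= r.
Proof. by move=> s0; apply: affine_within; rewrite prednK. Qed.

(** The vertex [u] itself contributes 0 to the average of the distances from the
    vertices to [u], whence the factor [(n - 1) / n]. *)
Lemma barycenter_mesh s D u : u \in s -> mesh_le s D ->
  `|val (barycenter s) - val u| <= (1 - (size s)%:R^-1) * D.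
Proof.
move=> us sD; apply: le_trans (affine_norm _ _ _) _.
have s0 : (0 < size s)%N by case: s us {sD}.
have D0 : 0 <= D by rewrite (le_trans _ (sD _ us _ us)).
have iu : (index u s < (size s).-1.+1)%N by rewrite prednK // index_mem.
rewrite (bigD1 (Ordinal iu)) //= nth_index // subrr normr0 mulr0 add0r.
apply: (@le_trans _ _ (\sum_(i < (size s).-1.+1 | i != Ordinal iu) (size s)%:R^-1 * D)).
  apply: ler_sum => i _.
  have -> : val (center (size s).-1) 0 i = (size s)%:R^-1 :> R.
    by rewrite /= mxE prednK.
  apply: ler_wpM2l; rewrite ?invr_ge0 //.
  apply: sD => //; apply: mem_nth.
  by move: (ltn_ord i); rewrite [X in (_ < X)%N -> _]prednK.
rewrite sumr_const cardC1 card_ord /= -[leLHS]mulr_natl mulrA ler_wpM2r //.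
rewrite -subn1 natrB // mulrBl mul1r mulfV // pnatr_eq0.
by rewrite -lt0n.
Qed.

(** Subdivision shrinks the mesh by the factor [1 - 1 / N], uniformly for the
    simplices with at most [N] vertices.  The clause on [clustered] says that the
    subdivided simplex [t] stays in the convex hull of [s], as far as distances
    can tell; the induction needs it to bound the distance from the barycenter
    of [s] to the vertices of [t], which come from a face of [s]. *)
Lemma sd_vanish (K : pzRingType) N m (phi : seq simplex -> K) s D :
  (m <= N)%N -> 0 <= D -> size s = m -> mesh_le s D ->
  (forall t, size t = m -> (forall x r, clustered s x r -> clustered t x r) ->
     mesh_le t ((1 - N%:R^-1) * D) -> phi t = 0) ->
  sd barycenter m phi s = 0.
Proof.
move=> mN D0; elim: m mN phi s => [|m IH] mN phi s sm sD phi0.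
  by apply: phi0 => //; rewrite (size0nil sm).
rewrite /= bdE; apply: big1 => i _.
have im : (i < size s)%N by exact: ltn_ord.
rewrite IH ?mulr0 // ?(ltnW mN) //.
- by apply: succn_inj; rewrite -sm size_omit.
- by move=> u us v vs; apply: sD; apply: (@sub_omit _ i).
move=> t tm ts tD; have s0 : (0 < size s)%N by rewrite sm.
have hull x r : clustered s x r -> clustered t x r.
  by move=> sx; apply: ts => u us; apply: sx; apply: (@sub_omit _ i).
have bt u : u \in t -> `|val (barycenter s) - val u| <= (1 - N%:R^-1) * D.
  move=> ut; rewrite distrC; apply: (hull _ _ _ u ut) => v vs; rewrite distrC.
  apply: le_trans (barycenter_mesh vs sD) _; apply: ler_wpM2r => //.
  rewrite lerD2l lerN2 sm lef_pV2 ?posrE ?ltr0n //; last exact: leq_trans mN.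
  by rewrite ler_nat.
apply: phi0.
- by rewrite /= tm.
- move=> x r sx u; rewrite inE => /predU1P[->|/(hull _ _ sx)//].
  exact: barycenter_within.
- move=> u; rewrite inE => /predU1P[->|ut] v; rewrite inE => /predU1P[->|vt].
  + rewrite subrr normr0 mulr_ge0 // subr_ge0 invf_le1 ?ltr0n //.
      by rewrite ler1n; exact: leq_trans mN.
    exact: leq_trans mN.
  + by rewrite distrC; exact: bt.
  + exact: bt.
  + exact: tD.
Qed.

Lemma simplex_norm (u : simplex) : `|val u| <= 1.
Proof.
rewrite [leLHS]/Num.norm /= mx_normrE; apply/bigmax_leP; split => // -[i j] _ /=.
rewrite ord1 ger0_norm ?simplex_ge0 // -(simplex_sum1 u) (bigD1 j) //=.
by rewrite lerDl sumr_ge0 // => k _; exact: simplex_ge0.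
Qed.

Lemma std_simplex_compact : compact (std_simplex R n).
Proof.
apply: bounded_closed_compact.
  exists 1; split => // M M1 u us.
  by apply: le_trans (ltW M1); exact: (simplex_norm (exist _ u (mem_set us))).
have -> : std_simplex R n = \bigcap_i [set t : 'rV[R]_n.+1 | 0 <= t 0 i] `&`
    [set t | \sum_i t 0 i = 1].
  by apply/seteqP; split => t /= [t0 t1]; split => // i; [move=> _|]; exact: t0.
apply: closedI; first apply: closed_bigI => i _.
  by apply: (@closed_comp _ _ (fun t : 'rV[R]_n.+1 => t 0 i) [set x | 0 <= x]);
    [move=> t _; exact: coord_continuous|exact: closed_ge].
apply: (@closed_comp _ _ (fun t : 'rV[R]_n.+1 => \sum_i t 0 i) [set x | x = 1]).
  move=> t _; apply: (cvg_big (F := nbhs t) add_continuous) => i _.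
  exact: coord_continuous.
exact: closed_eq.
Qed.

End Mesh.

(** Compactness of the standard simplex, applied to the pullback of the cover
    along [s]; a covering with a uniform radius is what [near_covering] gives. *)
Lemma lebesgue_number (R : realType) (X : topologicalType) n (s : singular R n X)
    I (U : I -> set X) :
  (forall i, open (U i)) -> \bigcup_i U i = setT ->
  exists2 e : R, 0 < e & forall u : std_simplex R n,
    exists i, forall v : std_simplex R n, `|val v - val u| <= e -> U i (s v).
Proof.
move=> oU cU.
pose P e u := exists i, forall v : std_simplex R n, `|val v - u| <= e -> U i (s v).
have leb : \forall e \near (0 : R)^'+, std_simplex R n `<=` P e.
  have /compact_near_coveringP := std_simplex_compact (R := R) (n := n).
  apply.
  move=> x xs; pose u : std_simplex R n := exist _ x (mem_set xs).
  have [i _ Ui] : (\bigcup_i U i) (s u) by rewrite cU.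
  have : nbhs u (s @^-1` U i).
    by apply: (@cts_fun _ _ s); exact: open_nbhs_nbhs.
  move=> [_ [[W oW <-]] /= Wu WU].
  have /nbhs_ballP[d /= d0 dW] : nbhs x W by exact: open_nbhs_nbhs.
  have d2 : 0 < d / 2 by rewrite divr_gt0.
  near=> y e; exists i => v vy; apply: WU; apply: dW.
  rewrite -ball_normE /=; apply: le_lt_trans (ler_distD y _ _) _;
  rewrite [ltRHS]splitr ltrD //.
  by rewrite distrC; apply: le_lt_trans vy _ => /=; near: e; exact: nbhs_right_lt.
have [e [e0 eP]] := filter_ex (filterI (nbhs_right_gt (0 : R)) leb).
by exists e => // u; apply: eP; exact: set_valP.
Unshelve. all: by end_near. Qed.

(** * Cocycles vanishing on small simplices *)

Section SmallSimplices.
Context {R : realType} {K : comPzRingType} {X : topologicalType}.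
Implicit Types c : cochain R K X.

Definition vanishes_on (U : set X) c :=
  forall n (s : singular R n X), (forall t, U (s t)) -> c n s = 0.

Lemma eval_affine_comp c n p (s : singular R n X) (g : seq (std_simplex R n)) l :
  eval_affine c (s \o affine g : singular R p X) l = eval_affine c s (map (affine g) l).
Proof.
case: l => // v l; rewrite /eval_affine /= size_map; congr (c _ _).
by apply/continuousEP => t; rewrite /= affine_affine.
Qed.

(** Subdividing a singular simplex and then an affine simplex inside it are
    compatible, so iterating [subdivision] iterates [sd] within one simplex. *)
Lemma eval_subdivision c n (s : singular R n X) l :
  eval_affine (subdivision c) s l = sd barycenter (size l) (eval_affine c s) l.
Proof.
case: l => // v l; set l' := v :: l.
have gl : map (affine l') (vertices (size l)) = l' by exact: map_affine_vertices.
rewrite -[LHS]/(sd barycenter (size l') (eval_affine c _) (vertices (size l))).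
rewrite -[in RHS]gl size_map size_vertices -(sd_map (b := barycenter)).
- by congr (sd _ _ _ _); apply/funext => u; rewrite -eval_affine_comp.
- by move=> u; exact: barycenter_map.
- exact: size_vertices.
Qed.

Lemma subdivision_prism_vanishes_on U c :
  vanishes_on U c -> vanishes_on U (subdivision_prism c).
Proof.
move=> cU n s sU; rewrite /= /prism_fun.
rewrite (_ : eval_prism _ _ _ = fun=> 0) ?prism0 //.
by apply/funext => -[//|v l]; apply: cU => t; exact: sU.
Qed.

Section Cover.
Context {I : Type} (U : I -> set X).
Hypotheses (U_open : forall i, open (U i)) (U_cover : \bigcup_i U i = setT).

(** All the simplices of a sufficiently fine subdivision of [s] are so small that
    they lie in a single member of the cover. *)
Lemma iter_subdivision_vanish c : (forall i, vanishes_on (U i) c) ->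
  forall n (s : singular R n X), exists m, forall k, (m <= k)%N ->
  iter k subdivision c n s = 0.
Proof.
move=> cU n s; have [e e0 eP] := lebesgue_number s U_open U_cover.
pose r : R := 1 - n.+1%:R^-1.
have r0 : 0 <= r by rewrite subr_ge0 invf_le1 ?ltr0n // ler1n.
have r1 : r < 1 by rewrite ltrBlDr ltrDl invr_gt0 ltr0n.
have small k D l : 0 <= D -> size l = n.+1 -> mesh_le l D -> r ^+ k * D <= e ->
    eval_affine (iter k subdivision c) s l = 0.
  elim: k D l => [|k IH] D l D0 ln lD De.
    have [i iP] := eP (nth (vertex n 0) l 0).
    rewrite (eval_affineE _ _ ln); apply: (cU i) => t; apply: iP.
    apply: le_trans De; rewrite expr0 mul1r; apply: affine_within => //.
    by apply: lD; rewrite mem_nth ?ln.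
  rewrite [iter _ _ _]iterS eval_subdivision ln.
  apply: (sd_vanish (leqnn _) D0) => // t tn _ tD.
  by apply: IH tD _ => //; rewrite ?mulr_ge0 // mulrA -exprSr.
have : \forall k \near \oo, r ^+ k < e / 2.
  have := @cvg_expr R r; rewrite ger0_norm // => /(_ r1) rk.
  by apply: (cvgr_lt _ rk); rewrite divr_gt0.
move=> [m _ mP]; exists m => k mk.
have -> : iter k subdivision c n s = eval_affine (iter k subdivision c) s (vertices n).
  rewrite (@eval_affineE _ _ _ _ _ _ n) ?size_vertices //; congr (cochain_fun _ _).
  by apply/continuousEP => t; rewrite /= affine_vertices.
(* 2 bounds the diameter of the standard simplex for the norm of 'rV. *)
apply: (small k 2) => //; rewrite ?size_vertices //.
  move=> u _ v _; rewrite [leRHS](_ : _ = 1 + 1) //.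
  by apply: le_trans (ler_normB _ _) _; apply: lerD; exact: simplex_norm.
by rewrite -ler_pdivlMr // ltW //; exact: mP.
Qed.

(** Write [S] for subdivision and [T] for its prism.  As [z] is a cocycle,
    [z - S^m z] is the coboundary of [E m], the sum of the [S^i (T z)] for
    [i < m].  Since [T z] also vanishes on small simplices, for each simplex [s]
    the values [E m s] are stationary in [m]; their limit is a cochain whose
    coboundary is [z], because on each simplex [S^m z] vanishes for [m] large.
    The number [m] depends on the simplex, which is why a limit is needed. *)
Lemma small_cocycle_coboundary (z : cocycle R K X) :
  (forall i, vanishes_on (U i) (val z)) -> z \in coboundaries.
Proof.
move=> zU; pose E m := \sum_(i < m) iter i subdivision (subdivision_prism (val z)).
have iterB i (a b : cochain R K X) :
    iter i subdivision (a - b) = iter i subdivision a - iter i subdivision b.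
  by elim: i => //= i ->; rewrite raddfB.
have dprism : delta (subdivision_prism (val z)) = val z - subdivision (val z).
  have := subdivision_homotopy (val z); rewrite delta_cocycle.
  rewrite (_ : subdivision_prism 0 = 0) ?add0r //.
  by apply: cochainP => n s; exact: prism_fun0.
have dE m : delta (E m) = val z - iter m subdivision (val z).
  rewrite /E; elim: m => [|m IH]; first by rewrite big_ord0 raddf0 subrr.
  rewrite big_ord_recr raddfD /= IH.
  have -> : delta (iter m subdivision (subdivision_prism (val z))) =
      iter m subdivision (delta (subdivision_prism (val z))).
    by elim: m {IH} => //= m IH; rewrite delta_subdivision IH.
  by rewrite dprism iterB addrA subrK -iterSr.
have stab n (s : singular R n X) : exists m, forall k, (m <= k)%N -> E k n s = E m n s.
  have [m mP] := iter_subdivision_vanish (fun i => subdivision_prism_vanishes_on (zU i)) s.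
  exists m => k /subnKC <-; elim: (k - m)%N => [|j IH]; first by rewrite addn0.
  rewrite addnS /E big_ord_recr /= mP ?leq_addr // addr0; exact: IH.
pose st n s := sval (cid (stab n s)).
have stP n s k : (st n s <= k)%N -> E k n s = E (st n s) n s.
  by move=> sk; rewrite (svalP (cid (stab n s))).
have [N zN] := cochain_bounded (val z).
have c_bounded : bounded_family (fun n (s : singular R n X) => E (st n s) n s).
  exists N => n s Nn; rewrite /E.
  have F0 m (t : singular R n X) : iter m subdivision (subdivision_prism (val z)) n t = 0.
    elim: m t => [|m IH] t; last exact: subdivision_fun0.
    by apply: prism_fun0 => u; rewrite zN // leqW.
  elim: (st n s) => [|m IH]; first by rewrite big_ord0.
  by rewrite big_ord_recr /= IH F0 addr0.
apply/coboundariesP; exists (Cochain c_bounded); apply: cochainP => n s.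
have [m mP] := iter_subdivision_vanish zU s.
(* M is large enough for s and for all its faces. *)
pose M := (m + \sum_(i < n.+1) st n.-1 (face n.-1 (bump i) s))%N.
have -> : val z n s = delta (E M) n s.
  by rewrite dE /= mP ?leq_addr // subr0.
case: n s @M mP => // n s M mP; apply: eq_bigr => i _; congr (_ * _).
rewrite /= stP // /M /= (bigD1 i) //= addnCA; exact: leq_addr.
Qed.

End Cover.
End SmallSimplices.

(** * Restriction to a subspace *)

Lemma set_val_continuous (B : topologicalType) (U : set B) :
  continuous (set_val : U -> B).
Proof. exact: initial_continuous. Qed.

Definition inclusion (B : topologicalType) (U : set B) : continuousType U B :=
  mkcts (@set_val_continuous B U).

Section Restriction.
Context {R : realType} {K : comPzRingType} {B : topologicalType} (U : set B).

Lemma simplex_in_subspace n (s : singular R n B) : (forall t, U (s t)) ->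
  exists s' : singular R n U, inclusion U \o s' = s :> singular R n B.
Proof.
move=> sU; pose f (t : std_simplex R n) : U := exist _ (s t) (mem_set (sU t)).
have cf : continuous f.
  by apply: (@continuous_comp_initial _ _ _ set_val); exact: (@cts_fun _ _ s).
by exists (mkcts cf); exact/continuousEP.
Qed.

Lemma inclusion_inj n (s s' : singular R n U) :
  inclusion U \o s = inclusion U \o s' :> singular R n B -> s = s'.
Proof.
move=> /continuousEP ss'; apply/continuousEP => t.
by apply: val_inj; exact: ss'.
Qed.

Definition extension_fun (c : cochain R K U) n (s : singular R n B) : K :=
  if pselect (exists s' : singular R n U, inclusion U \o s' = s :> singular R n B)
  is left e then c n (projT1 (cid e)) else 0.

Fact extension_bounded (c : cochain R K U) : bounded_family (extension_fun c).
Proof.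
have [N cN] := cochain_bounded c; exists N => n s Nn.
by rewrite /extension_fun; case: pselect => // e; exact: cN.
Qed.

Definition extension (c : cochain R K U) : cochain R K B :=
  Cochain (extension_bounded c).

Lemma pullback_extension (c : cochain R K U) :
  pullback (inclusion U) (extension c) = c.
Proof.
apply: cochainP => n s; rewrite /= /extension_fun.
case: pselect => [e|]; last by case; exists s.
by congr (c n _); apply: inclusion_inj; rewrite (projT2 (cid e)).
Qed.

(** If [a] restricts to the coboundary of [c] on [U], then [a] minus the
    coboundary of any extension of [c] restricts to 0. *)
Lemma representative_vanishing_on (x : cohomology R K B) :
  cohomology_map (inclusion U) x = 0 ->
  exists2 z : cocycle R K B, \pi_(cohomology R K B)%qT z = x & vanishes_on U (val z).
Proof.
rewrite -[x in X in X -> _]reprK cohomology_map_pi => /eqP.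
rewrite -(raddf0 (\pi_(cohomology R K U)%qT)) -[_ == _]Quotient.idealrBE subr0.
move=> /coboundariesP[c ac].
have dP : delta (extension c) \in cocycles by apply/eqP; exact: delta_delta.
exists (repr x - Cocycle dP).
  rewrite -[RHS]reprK; apply/eqP; rewrite -[_ == _]Quotient.idealrBE.
  apply/coboundariesP; exists (- extension c).
  by rewrite addrAC subrr add0r raddfN [RHS]raddfN.
move=> n s /simplex_in_subspace[s' <-].
rewrite -[LHS]/(pullback (inclusion U) (val (repr x - Cocycle dP)) n s').
have E : pullback (inclusion U) (val (Cocycle dP)) = pullback (inclusion U) (val (repr x)).
  rewrite -[LHS]/(pullback (inclusion U) (delta (extension c))).
  by rewrite -delta_pullback pullback_extension -ac.
by rewrite !raddfB [X in _ - X]E subrr.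
Qed.

Lemma vanishes_on_cup (a b : cochain R K B) :
  vanishes_on U a \/ vanishes_on U b -> vanishes_on U (a * b).
Proof.
move=> ab n s sU; apply: big1 => p _.
by case: ab => h; rewrite h ?mul0r ?mulr0 // => t; exact: sU.
Qed.

End Restriction.

Lemma cohomology_map_comp (R : realType) (K : comPzRingType) (X Y Z : topologicalType)
    (f : continuousType X Y) (g : continuousType Y Z) (x : cohomology R K Z) :
  cohomology_map (g \o f : continuousType X Z) x = cohomology_map f (cohomology_map g x).
Proof.
rewrite -[x]reprK (cohomology_map_pi g) !cohomology_map_pi.
congr (\pi_(cohomology R K X)%qT _); apply: val_inj.
by apply: cochainP => n s /=; congr (cocycle_val _ _ _); exact/continuousEP.
Qed.

(** * Local sections of the path fibration *)

Section UnitInterval.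
Context {R : realType}.
Local Notation I := (@unit_interval R).

Lemma unit_interval_compact : compact [set: I].
Proof.
have <- : valL_ (I0 R) (@id I) @` (@unit_interval R) = setT.
  apply/seteqP; split => // t _; exists (val t); first exact: set_valP.
  exact: (congr1 (@^~ t) (valLK (I0 R) (@id I))).
apply: continuous_compact; last exact: segment_compact.
by apply/subspace_valL_continuousP' => x; exact: cvg_id.
Qed.

Lemma unit_interval_hausdorff : hausdorff_space I.
Proof.
move=> p q pq; apply: val_inj; apply: Rhausdorff => A C pA qC.
have [r [rA rC]] : (set_val @^-1` A : set I) `&` (set_val @^-1` C) !=set0.
  by apply: pq; exact: set_val_continuous.
by exists (val r).
Qed.

Lemma unit_interval_locally_compact : locally_compact [set: I].
Proof.
move=> x _; exists setT; first by rewrite withinET; exact: filterT.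
by split; [exact: unit_interval_compact|exact: closedT].
Qed.

End UnitInterval.

Section Sections.
Context {R : realType} {K : comPzRingType} {X : topologicalType} (Y : set X).

(** A section over [U] is a homotopy from the inclusion of [U] to the map
    [(x, y) |-> (y, y)]: move the first coordinate along the chosen path.  The
    latter map factors through the diagonal, which kills zero-divisors. *)
Lemma zero_divisors_restrict (U : set (X * Y)%type) (x : cohomology R K (X * Y)%type) :
  has_section_on (@endpoints R X Y) U -> zero_divisors x ->
  cohomology_map (inclusion U) x = 0.
Proof.
move=> [s [cs sU]] xZ.
pose pth (u : U) : {compact-open, @unit_interval R -> X} := val (s u).
have cpth : continuous pth.
  move=> u; apply: (@continuous_comp _ _ _ s set_val); first exact: cs.
  exact: set_val_continuous.
have cu : continuous (uncurry pth).
  apply: continuous_uncurry => //.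
  - exact: unit_interval_locally_compact.
  - exact: unit_interval_hausdorff.
  - by move=> u; case: (set_mem (valP (s u))).
have cend : continuous (fun u : U => (val u).2).
  move=> u; apply: (@continuous_comp _ _ _ set_val snd); first exact: set_val_continuous.
  exact: cvg_snd.
have cend' : continuous (fun p : U * @unit_interval R => (val p.1).2).
  move=> p; apply: (@continuous_comp _ _ _ fst (fun u : U => (val u).2)); first exact: cvg_fst.
  exact: cend.
pose H : continuousType (U * @unit_interval R)%type (X * Y)%type :=
  pairing (mkcts cu) (mkcts cend').
rewrite (cohomology_map_homotopic (H := H) (f1 := relative_diagonal (Y := Y) \o mkcts cend)).
- by rewrite cohomology_map_comp xZ raddf0.
- move=> u; rewrite -[LHS]/(val (s u) (I0 R), (val u).2) -[RHS]/(val u).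
  by rewrite -(sU u).
- move=> u; rewrite -[LHS]/(val (s u) (I1 R), (val u).2).
  by rewrite -[RHS]/(val (val u).2, (val u).2) -(sU u).
Qed.

End Sections.

Theorem theorem2p11 (R : realType) (K : comPzRingType) (X : topologicalType)
    (Y : set X) (k : nat) (alpha : 'I_k -> cohomology R K (X * Y)%type)
    (alpha_Z : forall i, zero_divisors (alpha i))
    (alpha_neq0 : \prod_(i < k) alpha i != 0) :
  (k%:R%:E < TC R Y)%E.
Proof.
rewrite /TC /genus; case: pselect => [ex_m|_]; last exact: ltry.
rewrite lte_fin ltr_nat ltnNge; apply/negP.
case: ex_minnP => m /asboolP[U [oU cU sU]] _ mk.
move: alpha_neq0 => /eqP; apply.
(* The cover is padded with empty sets, to have as many sets as factors. *)
pose V (i : 'I_k) := [set b : (X * Y)%type | exists im : (i < m)%N, U (Ordinal im) b].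
have oV i : open (V i).
  have [im|im] := boolP (i < m)%N.
    have -> : V i = U (Ordinal im); last exact: oU.
    apply/seteqP; split => b; last by move=> Ub; exists im.
    by move=> [im']; rewrite (_ : Ordinal im' = Ordinal im) //; exact: val_inj.
  have -> : V i = set0; last exact: open0.
  by apply/seteqP; split => b // -[im']; rewrite im' in im.
have cV : \bigcup_i V i = setT.
  rewrite -subTset -cU => b [i _ Ub]; exists (widen_ord mk i) => //=.
  exists (ltn_ord i); rewrite (_ : Ordinal _ = i) //; exact: val_inj.
have rep i : exists z : cocycle R K (X * Y)%type,
    \pi_(cohomology R K (X * Y)%type)%qT z = alpha i /\ vanishes_on (V i) (val z).
  have [im|im] := boolP (i < m)%N.
    have [z za zU] := representative_vanishing_on
      (zero_divisors_restrict (sU (Ordinal im)) (alpha_Z i)).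
    exists z; split => // n s sV; apply: zU => t; have [im'] := sV t.
    by rewrite (_ : Ordinal im' = Ordinal im) //; exact: val_inj.
  exists (repr (alpha i)); split; first exact: reprK.
  by move=> n s sV; have [im'] := sV (center n); rewrite im' in im.
have [z zP] := choice rep.
have prodE (r : seq 'I_k) : \prod_(i <- r) alpha i =
    \pi_(cohomology R K (X * Y)%type)%qT (\prod_(i <- r) z i).
  elim: r => [|i r IH]; first by rewrite !big_nil.
  by rewrite !big_cons IH pi_cohomologyM (zP i).1.
rewrite prodE -(raddf0 (\pi_(cohomology R K (X * Y)%type)%qT)).
apply/eqP; rewrite -[_ == _]Quotient.idealrBE subr0.
apply: (small_cocycle_coboundary oV cV) => i.
have : i \in index_enum 'I_k by exact: mem_index_enum.
elim: (index_enum _) => // j r IH; rewrite inE big_cons rmorphM /=.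
by move=> /predU1P[<-|/IH ir]; apply: vanishes_on_cup; [left; exact: (zP _).2|right].
Qed.
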